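(* Let $A\in\mathbb{R}^{n\times n}$, $B\in\mathbb{R}^{m\times m}$, $C,D\in\mathbb{R}^{n\times m}$, where $A$ and $-B$ have no common eigenvalues, and let $f:\mathbb{R}^{n\times m}\to\mathbb{R}$ be a linear function. Let $M,N\in\mathbb{R}^{n\times m}$ be the solutions to the Sylvester equations $AM+MB=D$ and $AN+NB=-C$, respectively. Assume that $1-f(N)\neq 0$. Then the solution $X\in\mathbb{R}^{n\times m}$ to the matrix equation $$AX+XB+f(X)\,C=D$$ (i.e. its one and only solution) is given by $$X=M+\sigma N,\qquad \sigma=\frac{f(M)}{1-f(N)}.$$
   Context: Since $A$ and $-B$ have no common eigenvalues, the operator $\mathcal{L}:X\mapsto AX+XB$ on $\mathbb{R}^{n\times m}$ is invertible, so that $M=\mathcal{L}^{-1}(D)$ and $N=-\mathcal{L}^{-1}(C)$ are well defined. *)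

(* Defs.v *)
From mathcomp Require Import all_boot all_order all_algebra.
From mathcomp Require Import reals complex.

Set Implicit Arguments.
Unset Strict Implicit.
Unset Printing Implicit Defensive.

Import Order.TTheory GRing.Theory Num.Theory.
Local Open Scope ring_scope.

(* The eigenvalues of a real matrix are its complex ones. MathComp's
   [eigenvalue] uses row (left) eigenvectors, which gives the same spectrum as
   column eigenvectors. *)
Definition ceigenvalue (R : realType) (n : nat) (A : 'M[R]_n) (z : R[i]) : bool :=
  eigenvalue (map_mx (real_complex R) A) z.

Definition no_common_eigenvalue (R : realType) (n m : nat)
    (A : 'M[R]_n) (B : 'M[R]_m) : Prop :=
  forall z : R[i], ~ (ceigenvalue A z /\ ceigenvalue B z).

(* Main.v *)
Require Import Defs.
From mathcomp Require Import all_boot all_order all_algebra.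
From mathcomp Require Import reals complex.
From mathcomp Require Import ring.

Set Implicit Arguments.
Unset Strict Implicit.
Unset Printing Implicit Defensive.

Import Order.TTheory GRing.Theory Num.Theory.
Local Open Scope ring_scope.

(** Write [L X] for the Sylvester operator [A *m X + X *m B]. It is injective:
    [L X = 0] says that [X] intertwines [A] with [- B], hence also [p(A)] with
    [p(- B)] for every polynomial [p]. The characteristic polynomials of [A]
    and [- B] have no common complex root, so they satisfy a Bezout identity
    over the reals, and Cayley-Hamilton turns that identity into [X = 0]
    ([intertwiner_eq0]).

    The equation [L X + f X *: C = D] reads [L X = L (M + f X *: N)], that is
    [X = M + f X *: N] by injectivity. The only unknown left in it is the scalar
    [f X]; applying [f] gives [(1 - f N) * f X = f M], whose solution is
    [sigma]. *)

Lemma intertwiner_horner_mx (F : comNzRingType) (n m : nat)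
    (A : 'M[F]_n.+1) (B : 'M[F]_m.+1) (X : 'M[F]_(n.+1, m.+1)) (p : {poly F}) :
  A *m X = X *m B -> horner_mx A p *m X = X *m horner_mx B p.
Proof.
move=> AX; elim/poly_ind: p => [|p c IHp].
  by rewrite !rmorph0 mul0mx mulmx0.
rewrite !rmorphD !rmorphM /= !horner_mx_X !horner_mx_C.
by rewrite mulmxDl mulmxDr -!mulmxE -mulmxA AX !mulmxA IHp scalar_mxC.
Qed.

(** With a Bezout identity [u * char_poly A + v * char_poly B = 1],
    Cayley-Hamilton for [B] leaves [X = X *m (u * char_poly A)(B)], and moving
    this polynomial to the left of [X] makes it vanish by Cayley-Hamilton
    for [A]. *)
Lemma intertwiner_eq0 (F : fieldType) (n m : nat)
    (A : 'M[F]_n) (B : 'M[F]_m) (X : 'M[F]_(n, m)) :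
  coprimep (char_poly A) (char_poly B) -> A *m X = X *m B -> X = 0.
Proof.
(* [horner_mx] is only defined for matrices of positive size. *)
case: n A X => [|n] A X; first by rewrite [X]flatmx0.
case: m B X => [|m] B X; first by rewrite [X]thinmx0.
move=> /Bezout_eq1_coprimepP [[u v] /= uv1] AX.
rewrite -[LHS]mulmx1 -[1%:M](rmorph1 (horner_mx B)) -uv1 rmorphD !rmorphM /=.
rewrite Cayley_Hamilton mulr0 addr0 -rmorphM -(intertwiner_horner_mx _ AX).
by rewrite rmorphM /= Cayley_Hamilton mulr0 mul0mx.
Qed.

(** Coprimality does not change under field extension, so it can be read off
    from the roots in the algebraically closed field [R[i]]. *)
Lemma no_common_eigenvalue_coprimep (R : realType) (n m : nat)
    (A : 'M[R]_n) (B : 'M[R]_m) :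
  no_common_eigenvalue A B -> coprimep (char_poly A) (char_poly B).
Proof.
move=> hAB; rewrite -(coprimep_map (real_complex R)) !map_char_poly.
apply/Pdiv.ClosedField.coprimepP => z rootAz; apply/negP => rootBz.
by apply: (hAB z); split; rewrite /ceigenvalue eigenvalue_root_char.
Qed.

Lemma sylvester_inj (R : realType) (n m : nat) (A : 'M[R]_n) (B : 'M[R]_m) :
  no_common_eigenvalue A (- B) ->
  injective (fun X : 'M[R]_(n, m) => A *m X + X *m B).
Proof.
move=> /no_common_eigenvalue_coprimep coAB X Y /= eqXY.
apply/eqP; rewrite -subr_eq0; apply/eqP; apply: (intertwiner_eq0 coAB).
apply/eqP; rewrite mulmxN -subr_eq0 opprK mulmxBr mulmxBl addrACA -opprD.
by rewrite eqXY subrr.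
Qed.

Theorem proposition2p1 (R : realType) (n m : nat)
    (A : 'M[R]_n) (B : 'M[R]_m) (C D : 'M[R]_(n, m))
    (hAB : no_common_eigenvalue A (- B))
    (f : {scalar 'M[R]_(n, m)})
    (M N : 'M[R]_(n, m))
    (hM : A *m M + M *m B = D)
    (hN : A *m N + N *m B = - C)
    (hfN : 1 - f N != 0) :
  let sigma := f M / (1 - f N) in
  forall X : 'M[R]_(n, m),
    A *m X + X *m B + f X *: C = D <-> X = M + sigma *: N.
Proof.
move=> sigma X.
have sylvMN a : A *m (M + a *: N) + (M + a *: N) *m B = D - a *: C.
  rewrite mulmxDr mulmxDl addrACA hM -scalemxAr -scalemxAl -scalerDr hN.
  by rewrite scalerN.
have fMN a : f (M + a *: N) = f M + a * f N by rewrite linearD linearZ.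
split=> [eqX | ->]; last first.
  have -> : f (M + sigma *: N) = sigma by rewrite fMN /sigma; field.
  by rewrite sylvMN subrK.
have XE : X = M + f X *: N.
  by apply: (sylvester_inj hAB); rewrite sylvMN -eqX addrK.
have fXE : f X * (1 - f N) = f M.
  by rewrite mulrBr mulr1 [X in X - _](congr1 f XE) fMN addrK.
by rewrite {1}XE /sigma -fXE mulfK.
Qed.
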